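(* Every weakly order-Rickart JB$^*$-triple is generated by its tripotents.
   Context: In a JB$^*$-triple $E$ write $L(a,b)z=\{a,b,z\}$ and $Q(a)z=\{a,z,a\}$. An inner ideal of $E$ is a linear subspace $I$ with $\{I,E,I\}\subseteq I$; for $x\in E$, $E(x)$ is the norm closure of $Q(x)(E)$, the norm-closed inner ideal generated by $x$. Elements $a,b$ are orthogonal ($a\perp b$) if $L(a,b)=0$; for subsets $I\perp J$ means $a\perp b$ for all $a\in I,b\in J$. A tripotent is $e\in E$ with $\{e,e,e\}=e$, and $E_i(e)$ is the $\frac i2$-eigenspace of $L(e,e)$, $i=0,1,2$. $E_2(e)$ is a JB$^*$-algebra with unit $e$, product $x\circ_e y=\{x,e,y\}$ and involution $x^{*_e}=\{e,x,e\}$. $E$ is a weakly order-Rickart JB$^*$-triple if given $x\in E$ and an inner ideal $J\subseteq E$ with $E(x)\perp J$, there exists a tripotent $e\in E$ such that $x$ is a positive element of the JB$^*$-algebra $E_2(e)$ and $J\subseteq E_0(e)$. ''Generated by its tripotents'' means that every element of $E$ can be approximated in norm by finite linear combinations of tripotents in $E$. *)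

(* Defs.v *)
From mathcomp Require Import all_boot all_order all_algebra.
From mathcomp Require Import all_classical all_reals all_analysis.
From mathcomp Require Import complex.

Set Implicit Arguments.
Unset Strict Implicit.
Unset Printing Implicit Defensive.

Import Order.TTheory GRing.Theory Num.Theory.
Import numFieldNormedType.Exports.

Local Open Scope classical_set_scope.
Local Open Scope ring_scope.
Local Open Scope complex_scope.

Section operators.
Variables (R : realType) (E : completeNormedModType R[i]).
Implicit Type T : E -> E.

Definition op_exp T (x : E) : E :=
  limn (series (fun n : nat => (n`!%:R : R[i])^-1 *: iter n T x)).

(* exp(itT) is invertible with inverse exp(-itT), so ||exp(itT)|| = 1 for all
   real t exactly when every exp(itT) is isometric (the latter also makes sense
   when E = 0).  Here 0 +i* t is the number i times t in R[i]. *)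
Definition hermitian_op T : Prop :=
  forall (t : R) (x : E), `|op_exp (fun y => (0 +i* t) *: T y) x| = `|x|.

Definition op_invertible T : Prop :=
  exists S : {linear E -> E}, [/\ continuous S, cancel T S & cancel S T].

Definition op_spectrum T : set R[i] :=
  [set lambda | ~ op_invertible (fun x => T x - lambda *: x)].

End operators.

(* Linearity in the third variable follows from tripleC and triple_linear.
   In R[i], 0 <= lambda means that lambda is real and nonnegative. *)
Record JBTriple (R : realType) := {
  jb_space :> completeNormedModType R[i] ;
  triple : jb_space -> jb_space -> jb_space -> jb_space ;
  triple_continuous :
    continuous (fun p : jb_space * jb_space * jb_space =>
                  triple p.1.1 p.1.2 p.2) ;
  tripleC : forall x y z, triple x y z = triple z y x ;
  triple_linear : forall (k : R[i]) x x' y z,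
    triple (k *: x + x') y z = k *: triple x y z + triple x' y z ;
  triple_antilinear : forall (k : R[i]) x y y' z,
    triple x (k *: y + y') z = k^* *: triple x y z + triple x y' z ;
  triple_jordan : forall a b x y z,
    triple a b (triple x y z) =
    triple (triple a b x) y z - triple x (triple b a y) z
      + triple x y (triple a b z) ;
  triple_hermitian : forall a, hermitian_op (triple a a) ;
  triple_spectrum_ge0 : forall a lambda,
    op_spectrum (triple a a) lambda -> 0 <= lambda ;
  triple_norm : forall a, `|triple a a a| = `|a| ^+ 3
}.

Section triples.
Variables (R : realType) (E : JBTriple R).
Implicit Types (a b e x y z : E) (I J : set E).

Definition opL a b z : E := triple a b z.
Definition opQ a z : E := triple a z a.

Definition linear_subspace I : Prop :=
  I 0 /\ forall (k : R[i]) x y, I x -> I y -> I (k *: x + y).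

Definition inner_ideal I : Prop :=
  linear_subspace I /\ forall x y z, I x -> I z -> I (triple x y z).

Definition ideal_gen x : set E := closure (range (opQ x)).

Definition orthogonal a b : Prop := forall z, opL a b z = 0.

Definition orthogonal_sets I J : Prop :=
  forall a b, I a -> J b -> orthogonal a b.

Definition tripotent e : Prop := triple e e e = e.

Definition peirce (k : nat) e : set E :=
  [set x | opL e e x = (k%:R / 2 : R[i]) *: x].

Definition jprod e x y : E := triple x e y.
Definition jinvol e x : E := triple e x e.

(* Invertibility in the unital Jordan algebra peirce 2 e, whose unit is e. *)
Definition jinvertible e x : Prop :=
  exists y, [/\ peirce 2 e y, jprod e x y = e & jprod e (jprod e x x) y = x].

Definition jspectrum e x : set R[i] :=
  [set lambda | ~ jinvertible e (x - lambda *: e)].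

Definition jpositive e x : Prop :=
  [/\ peirce 2 e x, jinvol e x = x
    & forall lambda, jspectrum e x lambda -> 0 <= lambda].

Definition weakly_order_rickart : Prop :=
  forall x J, inner_ideal J -> orthogonal_sets (ideal_gen x) J ->
    exists e, [/\ tripotent e, jpositive e x & J `<=` peirce 0 e].

Definition tripotent_combinations : set E :=
  [set y | exists (n : nat) (c : 'I_n -> R[i]) (e : 'I_n -> E),
     (forall i, tripotent (e i)) /\ y = \sum_(i < n) c i *: e i].

Definition generated_by_tripotents : Prop :=
  closure tripotent_combinations = setT.

End triples.

Arguments weakly_order_rickart {R} E.
Arguments generated_by_tripotents {R} E.

(* Main.v *)
Require Import Defs.
From mathcomp Require Import all_boot all_order all_algebra.
From mathcomp Require Import all_classical all_reals all_analysis.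
From mathcomp Require Import complex ring lra.

Set Implicit Arguments.
Unset Strict Implicit.
Unset Printing Implicit Defensive.

Import Order.TTheory GRing.Theory Num.Theory.
Import numFieldNormedType.Exports.

Local Open Scope classical_set_scope.
Local Open Scope ring_scope.
Local Open Scope complex_scope.

(** Taking J = 0 in the order-Rickart condition, every x is a positive element
of the JB*-algebra E_2(e) of some tripotent e. Put r = ||x||. The spectrum of
x in E_2(e) then lies in [0, r], that of the self-adjoint element x - (r/2) e
in [-r/2, r/2], and therefore ||x - (r/2) e|| <= r/2
([jpositive_midpoint]). Applying this to the remainder again and again halves
the error each time ([tripotent_approx]), so that finite combinations of
tripotents converge to x.

The analytic core is that the norm of a self-adjoint element y of E_2(e) is
attained on its spectrum ([selfadjoint_spectral_norm]). For such y the triple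
cube is the Jordan cube, so the norm axiom gives ||y^n|| = ||y||^n for every
power n of 3. It remains to see that this limit is controlled by the spectrum,
which is done by averaging over roots of unity instead of by complex function
theory. Suppose that y - l e is invertible whenever |l| >= rho = ||y||.
The average of -nu (y - nu)^-1 over the n points nu with nu^n = l^n acts as the
inverse of e - (y/l)^n ([jinverse_average]). If |l| > rho, these averages tend
to e as n grows. The resolvent is bounded on the circle |l| = rho, by
compactness, and Lipschitz near it, so the averages for |l| = rho also come
close to e. This forces (y/rho)^n to become small, although its norm is 1. That
the spectrum of x does not exceed r is a Neumann series ([jinverse_large]).

The algebra needed about E_2(e) is derived from the Jordan triple identity: the
fundamental formula Q(Q(x)y) = Q(x)Q(y)Q(x) ([opQ_opQ]) and the Jordan identity
([jordan_identity]). If w is the Jordan inverse of z, the fundamental formula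
makes U_w the inverse operator of U_z, and this yields a resolvent identity
([jinverse_shift]). As E_2(e) is not associative, multiplication by y^n is not
the n-th iterate of multiplication by y; it is reached through a recursion for
these operators ([jpow_rec]). *)

(** * Linear identities in modules *)

Section linear_expressions.
Variables (K : fieldType) (V : lmodType K).

(** Syntax of the linear expressions of a module. Two of them are equal as soon
as each atom has the same coefficient in both, so the tactic [module] below
reduces a linear identity between vectors to identities between scalars. *)
Inductive lin_expr :=
| LVar of nat | LZero | LAdd of lin_expr & lin_expr | LOpp of lin_expr
| LScale of K & lin_expr | LMuln of lin_expr & nat.

Fixpoint lin_eval (env : seq V) t : V :=
  match t with
  | LVar n => nth 0 env n
  | LZero => 0
  | LAdd a b => lin_eval env a + lin_eval env b
  | LOpp a => - lin_eval env a
  | LScale k a => k *: lin_eval env a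
  | LMuln a n => lin_eval env a *+ n
  end.

Fixpoint lin_coef (i : nat) t : K :=
  match t with
  | LVar n => if Nat.eqb i n then 1 else 0
  | LZero => 0
  | LAdd a b => lin_coef i a + lin_coef i b
  | LOpp a => - lin_coef i a
  | LScale k a => k * lin_coef i a
  | LMuln a n => lin_coef i a *+ n
  end.

Lemma lin_evalE env t :
  lin_eval env t = \sum_(i < size env) lin_coef i t *: nth 0 env i.
Proof.
elim: t => [n||a IHa b IHb|a IHa|k a IHa|a IHa n] /=.
- have [ltn|gen] := ltnP n (size env).
    rewrite (bigD1 (Ordinal ltn)) //= PeanoNat.Nat.eqb_refl scale1r.
    rewrite big1 ?addr0 // => i; rewrite -val_eqE /= => /eqP ni.
    by case: PeanoNat.Nat.eqb_spec => // _; rewrite scale0r.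
  rewrite nth_default // big1 // => i _.
  case: PeanoNat.Nat.eqb_spec => [ni|]; last by rewrite scale0r.
  by move: (ltn_ord i); rewrite ni ltnNge gen.
- by rewrite big1 // => i _; rewrite scale0r.
- by rewrite IHa IHb -big_split; apply: eq_bigr => i _; rewrite scalerDl.
- by rewrite IHa -sumrN; apply: eq_bigr => i _; rewrite scaleNr.
- by rewrite IHa scaler_sumr; apply: eq_bigr => i _; rewrite scalerA.
- by rewrite IHa -sumrMnl; apply: eq_bigr => i _; rewrite scalerMnl.
Qed.

Fixpoint lin_coef_eq (n : nat) t1 t2 : Prop :=
  if n is m.+1 then lin_coef m t1 = lin_coef m t2 /\ lin_coef_eq m t1 t2
  else True.

Lemma lin_eval_eq env t1 t2 :
  lin_coef_eq (size env) t1 t2 -> lin_eval env t1 = lin_eval env t2.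
Proof.
move=> h; rewrite !lin_evalE; apply: eq_bigr => i _; congr (_ *: _).
elim: (size env) h i => [|n IH] /=; first by move=> _ [].
move=> [hn h] i; have [ltin|] := ltnP i n; first exact: (IH h (Ordinal ltin)).
case: i => i /= ltin ni.
by have -> : i = n by apply/eqP; rewrite eqn_leq ni -ltnS ltin.
Qed.

(** Linear arithmetic with a known equation u = v: the remaining goal is an
identity that holds for all values of the atoms, hence is within reach of
[module]. *)
Lemma eq_from_multiple (k : K) (u v x y : V) :
  u = v -> x - y = k *: (u - v) -> x = y.
Proof.
by move=> ->; rewrite subrr scaler0 => /eqP; rewrite subr_eq0 => /eqP.
Qed.

Lemma eq_from_combination (k k' : K) (u v u' v' x y : V) :
  u = v -> u' = v' -> x - y = k *: (u - v) + k' *: (u' - v') -> x = y.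
Proof.
move=> -> ->; rewrite !subrr !scaler0 addr0 => /eqP.
by rewrite subr_eq0 => /eqP.
Qed.

End linear_expressions.

Ltac lin_index x env :=
  lazymatch env with
  | nil => fail
  | cons ?y ?env' =>
    match constr:(tt) with
    | _ => let _ := match constr:(tt) with _ => constr_eq x y end in constr:(O)
    | _ => let n := lin_index x env' in constr:(S n)
    end
  end.

Ltac lin_atoms V t env :=
  lazymatch t with
  | (?a + ?b)%R => let env := lin_atoms V a env in lin_atoms V b env
  | (- ?a)%R => lin_atoms V a env
  | (_ *: ?a)%R => lin_atoms V a env
  | (?a *+ _)%R => lin_atoms V a env
  | 0%R => env
  | _ => match constr:(tt) with
         | _ => let _ := lin_index t env in env
         | _ => constr:(@cons V t env)
         end
  end.

Ltac lin_reify K t env :=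
  lazymatch t with
  | (?a + ?b)%R => let u := lin_reify K a env in let v := lin_reify K b env in
                   constr:(LAdd u v)
  | (- ?a)%R => let u := lin_reify K a env in constr:(LOpp u)
  | (?k *: ?a)%R => let u := lin_reify K a env in constr:(LScale k u)
  | (?a *+ ?n)%R => let u := lin_reify K a env in constr:(LMuln u n)
  | 0%R => constr:(LZero K)
  | _ => let n := lin_index t env in constr:(LVar K n)
  end.

Ltac module_with K V :=
  lazymatch goal with
  | |- @eq ?T ?x ?y =>
    let env := lin_atoms T x (@nil T) in
    let env := lin_atoms T y env in
    let u := lin_reify K x env in
    let v := lin_reify K y env in
    refine (@lin_eval_eq K V env u v _);
    cbn [size lin_coef_eq lin_coef Nat.eqb];
    repeat split; try first [ring | by field]
  end.

Ltac module :=
  lazymatch goal with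
  | E : JBTriple ?R |- _ =>
    module_with (R[i] : fieldType) (E : lmodType R[i])
  end.

(** * Multilinearity of the triple product *)

Section jordan_triple.
Variables (R : realType) (E : JBTriple R).
Implicit Types (a b c d e x y z u v w : E) (k : R[i]).

Local Notation "{< x , y , z >}" := (@triple R E x y z).

Lemma triple_linear3 k x y z z' :
  {<x, y, k *: z + z'>} = k *: {<x, y, z>} + {<x, y, z'>}.
Proof. by rewrite tripleC triple_linear !(tripleC _ y x). Qed.

Lemma triple0l y z : {<0, y, z>} = 0.
Proof.
have := triple_linear 1 0 0 y z; rewrite !scale1r addr0 => /eqP.
by rewrite -subr_eq subrr eq_sym => /eqP.
Qed.
Lemma triple0r x y : {<x, y, 0>} = 0.
Proof. by rewrite tripleC triple0l. Qed.
Lemma triple0m x z : {<x, 0, z>} = 0.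
Proof.
have := triple_antilinear 1 x 0 0 z; rewrite rmorph1 !scale1r addr0 => /eqP.
by rewrite -subr_eq subrr eq_sym => /eqP.
Qed.
Lemma tripleDl x x' y z : {<x + x', y, z>} = {<x, y, z>} + {<x', y, z>}.
Proof. by rewrite -[x in LHS]scale1r triple_linear scale1r. Qed.
Lemma tripleDr x y z z' : {<x, y, z + z'>} = {<x, y, z>} + {<x, y, z'>}.
Proof. by rewrite -[z in LHS]scale1r triple_linear3 scale1r. Qed.
Lemma tripleDm x y y' z : {<x, y + y', z>} = {<x, y, z>} + {<x, y', z>}.
Proof. by rewrite -[y in LHS]scale1r triple_antilinear rmorph1 scale1r. Qed.
Lemma tripleZl k x y z : {<k *: x, y, z>} = k *: {<x, y, z>}.
Proof. by rewrite -[_ *: x]addr0 triple_linear triple0l addr0. Qed.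
Lemma tripleZr k x y z : {<x, y, k *: z>} = k *: {<x, y, z>}.
Proof. by rewrite -[_ *: z]addr0 triple_linear3 triple0r addr0. Qed.
Lemma tripleZm k x y z : {<x, k *: y, z>} = k^* *: {<x, y, z>}.
Proof. by rewrite -[_ *: y]addr0 triple_antilinear triple0m addr0. Qed.
Lemma tripleNl x y z : {<- x, y, z>} = - {<x, y, z>}.
Proof. by rewrite -scaleN1r tripleZl scaleN1r. Qed.
Lemma tripleNm x y z : {<x, - y, z>} = - {<x, y, z>}.
Proof. by rewrite -scaleN1r tripleZm rmorphN1 scaleN1r. Qed.
Lemma tripleNr x y z : {<x, y, - z>} = - {<x, y, z>}.
Proof. by rewrite -scaleN1r tripleZr scaleN1r. Qed.

(** * Fundamental identities of Jordan triples *)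

(** In the Jordan identity for L(x,y) applied to {x,y,z}, the term
{x,y,{x,y,z}} occurs on both sides and cancels. *)
Lemma triple_shift x y z : {<x, {<y, x, y>}, z>} = {<{<x, y, x>}, y, z>}.
Proof.
apply: (eq_from_multiple (k := 1) (triple_jordan x y x y z)).
module.
Qed.

(** The Jordan identity, applied to {x,y,{x,z,x}} and to {x,z,{x,y,x}}, gives
two linear equations between these two elements and {x,{y,x,z},x}; they
determine the first because 3 is invertible. *)
Lemma triple_exchange x y z :
  {<x, y, {<x, z, x>}>} = {<x, {<y, x, z>}, x>}.
Proof.
have h1 := triple_jordan x y x z x; have h2 := triple_jordan x z x y x.
rewrite (tripleC {<x, y, x>}) in h1.
rewrite (tripleC {<x, z, x>}) (tripleC z x y) in h2.
apply: (eq_from_combination (k := - 3^-1) (k' := - 2 / 3) h1 h2).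
module.
Qed.

(** This solves the Jordan identity for L(z,y){x,y,x} for its middle term. For
a tripotent y the right-hand side becomes the operator [jU] of the Jordan
product of y. *)
Lemma triple_inner_quadratic x y z :
  {<x, {<y, z, y>}, x>} =
    {<x, y, {<z, y, x>}>} + {<x, y, {<z, y, x>}>} - {<z, y, {<x, y, x>}>}.
Proof.
apply: (eq_from_multiple (k := 1) (triple_jordan z y x y x)).
rewrite (tripleC {<z, y, x>} y); module.
Qed.

(** The fundamental formula. With p = Q(x)y, the Jordan identity expands
{p,z,{x,y,x}}; the exchange and shift identities bring each term into the form
{x,_,x}, and what then stands in the middle is Q(y)Q(x)z as computed by
[triple_inner_quadratic]. *)
Lemma opQ_opQ x y z : opQ (opQ x y) z = opQ x (opQ y (opQ x z)).
Proof.
rewrite /opQ; set p := {<x, y, x>}.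
have pzx : {<p, z, x>} = {<x, {<y, x, z>}, x>}.
  by rewrite tripleC triple_exchange (tripleC z).
have zpy : {<z, p, y>} = {<z, x, {<y, x, y>}>}.
  by rewrite tripleC triple_shift tripleC.
rewrite (triple_inner_quadratic y x z) !tripleDm tripleNm.
rewrite {2}/p triple_jordan pzx zpy (tripleC {<x, _, x>}) triple_exchange.
rewrite (tripleC z x y); module.
Qed.

(** Polarization of [triple_shift] in y. *)
Lemma triple_shift_linear x y z v :
  2 *: {<x, {<y, x, z>}, v>} = {<{<x, y, x>}, z, v>} + {<{<x, z, x>}, y, v>}.
Proof.
have h1 := triple_shift x y v; have h2 := triple_shift x z v.
have h := triple_shift x (y + z) v.
rewrite !(tripleDl, tripleDm, tripleDr) (tripleC z x y) in h.
have h3 : {<x, {<y, x, y>}, v>} + {<x, {<z, x, z>}, v>} =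
          {<{<x, y, x>}, y, v>} + {<{<x, z, x>}, z, v>} by rewrite h1 h2.
by apply: (eq_from_combination (k := 1) (k' := -1) h h3); module.
Qed.

(** * The Jordan product defined by a tripotent *)

Section jordan_product.
Variable e : E.

Local Notation "x ** y" := (@jprod R E e x y) (at level 40, left associativity).

Lemma jprodC x y : x ** y = y ** x. Proof. exact: tripleC. Qed.
Lemma jprodDl x y z : (x + y) ** z = x ** z + y ** z.
Proof. exact: tripleDl. Qed.
Lemma jprodDr x y z : x ** (y + z) = x ** y + x ** z.
Proof. exact: tripleDr. Qed.
Lemma jprodNl x y : (- x) ** y = - (x ** y). Proof. exact: tripleNl. Qed.
Lemma jprodNr x y : x ** (- y) = - (x ** y). Proof. exact: tripleNr. Qed.
Lemma jprodZl k x y : (k *: x) ** y = k *: (x ** y).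
Proof. exact: tripleZl. Qed.
Lemma jprodZr k x y : x ** (k *: y) = k *: (x ** y).
Proof. exact: tripleZr. Qed.
Lemma jprod0l x : 0 ** x = 0. Proof. exact: triple0l. Qed.
Lemma jprod0r x : x ** 0 = 0. Proof. exact: triple0r. Qed.

Definition jprodE :=
  (jprodDl, jprodDr, jprodNl, jprodNr, jprodZl, jprodZr, jprod0l, jprod0r).

Lemma jprod_sumr (I : Type) (s : seq I) (P : pred I) (F : I -> E) x :
  x ** (\sum_(i <- s | P i) F i) = \sum_(i <- s | P i) x ** F i.
Proof.
elim/big_rec2: _ => [|i y z _ <-]; [exact: jprod0r | exact: jprodDr].
Qed.

(** Write P, S, T for the operators L(y^3,e), L(y^2,y#) and L(y,(y^2)#), where
# stands for Q(e). The Jordan triple identity, used in both orders, computes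
the commutator of the multiplications by y^2 and by y as P - T and as S - P.
The polarized shift identity gives 2T = S + P. Hence P = S = T and the
commutator vanishes. *)
Lemma jordan_identity y v : y ** ((y ** y) ** v) = (y ** y) ** (y ** v).
Proof.
have h1 : (y ** y) ** (y ** v) = ((y ** y) ** y) ** v
    - {<y, {<e, y ** y, e>}, v>} + y ** ((y ** y) ** v).
  exact: triple_jordan.
have h2 : y ** ((y ** y) ** v) = ((y ** y) ** y) ** v
    - {<y ** y, {<e, y, e>}, v>} + (y ** y) ** (y ** v).
  by rewrite (jprodC (y ** y) y); exact: triple_jordan.
have h3 := triple_shift_linear y e {<e, y, e>} v.
rewrite triple_exchange [in X in _ + X]triple_shift in h3.
(* The weights -2/3, 1/3 and 1/3 of h1, h2 and h3 eliminate P, S and T. *)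
have h12 := congr2 (fun u u' => - (2 / 3) *: u + 3^-1 *: u') h1 h2.
apply: (eq_from_combination (k := 1) (k' := 3^-1) h12 h3).
rewrite /jprod; module.
Qed.

(** The part of [jordan_identity] for y + b that is linear in b, isolated by
comparing y + b with y - b. *)
Lemma jordan_identity_linear y b v :
  b ** ((y ** y) ** v) + y ** ((y ** b) ** v) *+ 2 =
  (y ** y) ** (b ** v) + (y ** b) ** (y ** v) *+ 2.
Proof.
have h1 := jordan_identity (y + b) v; have h2 := jordan_identity (y - b) v.
have h3 := jordan_identity b v.
rewrite !jprodE (jprodC b y) !opprK in h1 h2.
have h12 := congr2 (fun u u' => 2^-1 *: u - 2^-1 *: u') h1 h2.
apply: (eq_from_combination (k := 1) (k' := -1) h12 h3).
module.
Qed.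

(** The quadratic representation of the Jordan algebra E_2(e): in an associative
algebra with the symmetrized product it is v |-> z v z. *)
Definition jU z v : E := z ** (z ** v) *+ 2 - (z ** z) ** v.

Lemma jUE z v : jU z v = opQ z (opQ e v).
Proof.
rewrite /jU /opQ triple_inner_quadratic /jprod (tripleC v e z).
by rewrite (tripleC v e {<z, e, z>}) mulr2n.
Qed.

Lemma jU_jU z v u : jU (jU z v) u = jU z (jU v (jU z u)).
Proof. by rewrite !jUE !opQ_opQ. Qed.

Lemma jUD z v u : jU z (v + u) = jU z v + jU z u.
Proof. rewrite /jU !jprodE; module. Qed.
Lemma jUZ z k v : jU z (k *: v) = k *: jU z v.
Proof. rewrite /jU !jprodE; module. Qed.
Lemma jUN z v : jU z (- v) = - jU z v.
Proof. by rewrite -scaleN1r jUZ scaleN1r. Qed.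
Lemma jU0 z : jU z 0 = 0.
Proof. by rewrite -[X in jU _ X](scale0r (0 : E)) jUZ scale0r. Qed.

Hypothesis e_tri : tripotent e.

Definition in_E2 x := e ** x = x.

Lemma peirce2E x : peirce 2 e x <-> in_E2 x.
Proof. by rewrite /peirce /in_E2 /= divff ?scale1r // pnatr_eq0. Qed.

Lemma in_E2_e : in_E2 e. Proof. exact: e_tri. Qed.

Lemma in_E2M x y : in_E2 x -> in_E2 y -> in_E2 (x ** y).
Proof.
rewrite /in_E2 /jprod => hx hy.
by rewrite triple_jordan e_tri hx hy subrr add0r.
Qed.
Lemma in_E2D x y : in_E2 x -> in_E2 y -> in_E2 (x + y).
Proof. by rewrite /in_E2 jprodDr => -> ->. Qed.
Lemma in_E2Z k x : in_E2 x -> in_E2 (k *: x).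
Proof. by rewrite /in_E2 jprodZr => ->. Qed.
Lemma in_E2N x : in_E2 x -> in_E2 (- x).
Proof. by rewrite /in_E2 jprodNr => ->. Qed.

(** Here v is arbitrary in E: multiplication by e is the identity only on
E_2(e), but it commutes with every multiplication by an element of E_2(e). *)
Lemma jprod_unit_comm x v : in_E2 x -> e ** (x ** v) = x ** (e ** v).
Proof.
rewrite /in_E2 /jprod => hx.
by rewrite triple_jordan hx (in_E2_e : {<e, e, e>} = e) subrr add0r.
Qed.

Lemma jprod1r x : in_E2 x -> x ** e = x.
Proof. by rewrite jprodC. Qed.

Lemma jU1 v : in_E2 v -> jU e v = v.
Proof. by rewrite /jU /in_E2 => hv; rewrite in_E2_e !hv; module. Qed.

Lemma in_E2U x y : in_E2 x -> in_E2 y -> in_E2 (jU x y).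
Proof.
move=> hx hy; rewrite /jU mulr2n.
apply: in_E2D; last by apply/in_E2N/in_E2M/hy/in_E2M.
by apply: in_E2D; apply: (in_E2M hx); apply: in_E2M.
Qed.

Definition jinverse z w := [/\ in_E2 w, z ** w = e & (z ** z) ** w = z].

Lemma jinverse_U z w : in_E2 z -> jinverse z w -> jU z w = z.
Proof. by move=> hz [hw zw zzw]; rewrite /jU zw zzw jprod1r //; module. Qed.

(** In an associative algebra this is z z^-2 z = e. Here the linearized Jordan
identity at (z,w,w) gives z^2 o w^2 = e, and at (w,z,z) it gives
z o (z o w^2) = e. *)
Lemma jinverse_Usqr z w : in_E2 z -> jinverse z w -> jU z (w ** w) = e.
Proof.
move=> hz [hw zw zzw].
have h1 := jordan_identity_linear z w w.
rewrite zw hw zzw (jprodC w z) zw in_E2_e in h1.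
have h2 := jordan_identity_linear w z z.
rewrite (jprodC w z) zw hz (jprodC w z) zw in_E2_e in h2.
rewrite (jprodC _ (z ** z)) in h2.
rewrite /jU (jprodC z (w ** w)).
have h3 : (z ** z) ** (w ** w) = e.
  by apply: (eq_from_multiple (k := -1) h1); module.
rewrite h3 in h2 *.
by apply: (eq_from_multiple (k := 2) h2); module.
Qed.

(** By the fundamental formula U_z U_{w^2} U_z = U_e is the identity of E_2(e),
so U_z is injective there; then U_z U_w U_z = U_z can be cancelled by U_z. *)
Lemma jinverse_UK z w b :
  in_E2 z -> jinverse z w -> in_E2 b -> jU w (jU z b) = b.
Proof.
move=> hz hzw hb; have [hw _ _] := hzw.
have inj u : in_E2 u -> jU z u = 0 -> u = 0.
  move=> hu u0; rewrite -(jU1 hu) -(jinverse_Usqr hz hzw) jU_jU u0 !jU0 //.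
apply/eqP; rewrite -subr_eq0; apply/eqP/inj.
  by apply: in_E2D; [apply: (in_E2U hw); exact: in_E2U | exact: in_E2N].
by rewrite jUD jUN -jU_jU (jinverse_U hz hzw) subrr.
Qed.

(** A resolvent identity, obtained by expanding w' = U_w U_z w' with
z = (z + s e) - s e. It plays the role of w' = w - s w w', whose proof would
need w and w' to lie in a common associative subalgebra. As w' comes back only
with the factor s^2, it bounds w' by w when s is small. *)
Lemma jinverse_shift z w (s : R[i]) w' :
  in_E2 z -> jinverse z w -> jinverse (z + s *: e) w' ->
  w' = w - s *: (w ** w) + s ^+ 2 *: jU w w'.
Proof.
move=> hz hzw [hw' h1 h2]; have [hw _ _] := hzw.
have e1 : z ** w' = e - s *: w'.
  rewrite jprodDl jprodZl hw' in h1.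
  by apply: (eq_from_multiple (k := 1) h1); module.
have e2 : (z ** z) ** w' = z - s *: e + s ^+ 2 *: w'.
  rewrite !jprodE (jprodC z e) hz in_E2_e !hw' e1 in h2.
  by apply: (eq_from_multiple (k := 1) h2); module.
have e3 : jU z w' = z - s *: e + s ^+ 2 *: w'.
  by rewrite /jU e2 e1 !jprodE jprod1r // e1; module.
have Uwz : jU w z = w by rewrite -[X in jU _ X](jinverse_U hz hzw) jinverse_UK.
rewrite -[LHS](jinverse_UK hz hzw hw') e3 !jUD jUN !jUZ Uwz.
congr (_ - _ *: _ + _).
by rewrite /jU jprod1r // jprod1r; [module | exact: in_E2M].
Qed.

(** * Powers *)

Definition jpow y n : E := iter n (jprod e y) e.

Section powers.
Variable y : E.
Hypothesis hy : in_E2 y.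

Local Notation "y ^J n" := (jpow y n) (at level 30, right associativity).

Lemma jpowS n : y ^J n.+1 = y ** y ^J n. Proof. by []. Qed.
Lemma jpow1 : y ^J 1 = y. Proof. exact: jprod1r. Qed.

Lemma in_E2_pow n : in_E2 (y ^J n).
Proof. by elim: n => [|n IH]; [exact: in_E2_e | exact: in_E2M]. Qed.

Lemma jpow_sqr n : (y ** y) ** y ^J n = y ^J n.+2.
Proof.
elim: n => [|n IH].
  by rewrite jprod1r ?jpowS ?jprod1r //; exact: in_E2M.
by rewrite jpowS -jordan_identity IH.
Qed.

(** [jordan_identity_linear] with v and y^n in each other's places: it expresses
multiplication by y^(n+2) by multiplications by lower powers. *)
Lemma jpow_rec n v : y ^J n.+2 ** v =
  (y ** y) ** (y ^J n ** v) + y ^J n.+1 ** (y ** v) *+ 2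
  - y ** (y ^J n ** (y ** v)) *+ 2.
Proof.
have h := jordan_identity_linear y v (y ^J n).
rewrite jpow_sqr -jpowS in h.
rewrite (jprodC _ v) (jprodC _ v) (jprodC (y ^J n.+1)) (jprodC (y ^J n)).
by apply: (eq_from_multiple (k := 1) h); module.
Qed.

Lemma jpowD m n : y ^J m ** y ^J n = y ^J (m + n).
Proof.
suff [] : (forall n, y ^J m ** y ^J n = y ^J (m + n)) /\
          (forall n, y ^J m.+1 ** y ^J n = y ^J (m.+1 + n)) by [].
elim: m {n} => [|m [IH1 IH2]]; split=> // n; first exact: in_E2_pow.
- by rewrite jpow1.
- rewrite jpow_rec IH1 jpow_sqr -jpowS IH1 IH2 addSnnS -jpowS !addSnnS.
  by rewrite !addnS; module.
Qed.

Lemma jpow_comm n v : y ^J n ** (y ** v) = y ** (y ^J n ** v) /\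
  y ^J n ** ((y ** y) ** v) = (y ** y) ** (y ^J n ** v).
Proof.
pose P n := forall v, y ^J n ** (y ** v) = y ** (y ^J n ** v) /\
  y ^J n ** ((y ** y) ** v) = (y ** y) ** (y ^J n ** v).
suff [Pn _] : P n /\ P n.+1 by exact: Pn.
elim: n {v} => [|n [IH IH1]]; split=> // v.
- by split; rewrite /= jprod_unit_comm //; exact: in_E2M.
- by rewrite jpow1 jordan_identity.
- have [IHa IHb] := IH v; have [IH1a IH1b] := IH1 v.
  have [IHya IHyb] := IH (y ** v); have [IH1ya IH1yb] := IH1 (y ** v).
  have [IHyya _] := IH ((y ** y) ** v).
  split; rewrite !jpow_rec !mulr2n !jprodE.
  + by rewrite !(IHya, IHa, IH1a, IH1ya) !jordan_identity.
  + rewrite (jordan_identity y v) !(IHyb, IHb, IH1b, IH1yb, IHa).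
    by rewrite !jordan_identity.
Qed.

(** U_c c = {c,c,c} when c is self-adjoint; this is where the Jordan powers meet
the norm axiom of the triple. *)
Lemma jpow_cube n : opQ e (y ^J n) = y ^J n ->
  y ^J (n * 3) = {<y ^J n, y ^J n, y ^J n>}.
Proof.
move=> hn; have <- : jU (y ^J n) (y ^J n) = {<y ^J n, y ^J n, y ^J n>}.
  by rewrite jUE hn.
by rewrite /jU !jpowD mulr2n -addnA addrK !mulnS muln0 addn0.
Qed.

Lemma jpow_3exp_selfadjoint m : opQ e y = y ->
  opQ e (y ^J (expn 3 m)) = y ^J (expn 3 m).
Proof.
move=> ys; elim: m => [|m IH]; first by rewrite expn0 jpow1.
rewrite expnSr jpow_cube // -/(opQ _ _) -[in LHS]IH -opQ_opQ !IH.
by [].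
Qed.

Lemma jpow_3exp_norm m : opQ e y = y ->
  `|y ^J (expn 3 m)| = `|y| ^+ (expn 3 m).
Proof.
move=> ys; elim: m => [|m IH]; first by rewrite expn0 jpow1 expr1.
by rewrite expnSr jpow_cube ?jpow_3exp_selfadjoint // triple_norm IH exprM.
Qed.

(** For w = (y - nu)^-1 this is y^n w = (y^n - nu^n) w + nu^n w with the first
term expanded as a geometric sum. *)
Lemma jinverse_pow nu w n : jinverse (y - nu *: e) w ->
  y ^J n ** w = \sum_(i < n) nu ^+ (n - i.+1) *: y ^J i + nu ^+ n *: w.
Proof.
move=> [hw zw zzw]; pose g m := \sum_(i < m) nu ^+ (m - i.+1) *: y ^J i.
have gS m : g m.+1 = nu *: g m + y ^J m.
  rewrite /g big_ord_recr /= subnn scale1r scaler_sumr; congr (_ + _).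
  by apply: eq_bigr => i _; rewrite scalerA -exprS subSS subnSK.
have yg m : y ** g m = g m.+1 - nu ^+ m *: e.
  rewrite /g big_ord_recl /= subSS subn0 addrC addKr jprod_sumr.
  by apply: eq_bigr => i _; rewrite jprodZr subSS.
have yyg m : (y ** y) ** g m = g m.+2 - nu ^+ m *: y - nu ^+ m.+1 *: e.
  transitivity (y ** (y ** g m)); last first.
    by rewrite yg jprodDr jprodNr jprodZr yg jprod1r // addrAC.
  rewrite /g !jprod_sumr; apply: eq_bigr => i _.
  by rewrite !jprodZr jpow_sqr.
have yw : y ** w = e + nu *: w.
  move: zw; rewrite !jprodE hw => zw.
  by apply: (eq_from_multiple (k := 1) zw); module.
have yyw : (y ** y) ** w = y + nu *: e + nu ^+ 2 *: w.
  rewrite !jprodE (jprodC y e) hy in_E2_e !hw yw in zzw.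
  by apply: (eq_from_multiple (k := 1) zzw); module.
suff [] : y ^J n ** w = g n + nu ^+ n *: w /\
          y ^J n.+1 ** w = g n.+1 + nu ^+ n.+1 *: w by [].
elim: n => [|n [IH1 IH2]].
  by rewrite gS /g big_ord0 jpow1 /= hw yw; split; module.
split=> //; rewrite jpow_rec IH1 yw !jprodE IH1 IH2 yyg yyw !jprodE yw yg.
rewrite !(jprod1r (in_E2_pow _)) -jpowS.
rewrite !gS !exprS; module.
Qed.

(** With w_j = (y - nu_j)^-1, the average w of the elements -nu_j w_j over the
n-th roots nu_j of lambda^n satisfies w = (e - (y/lambda)^n)^-1: in the
geometric sums of [jinverse_pow] all powers of y but the zeroth average
out. *)
Lemma jinverse_average n lambda (nu : 'I_n -> R[i]) (a : 'I_n -> E) :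
    (0 < n)%N ->
    (forall j, nu j ^+ n = lambda ^+ n) ->
    (forall m, (0 < m < n)%N -> \sum_j nu j ^+ m = 0) ->
    (forall j, jinverse (y - nu j *: e) (a j)) ->
  let w := - n%:R^-1 *: \sum_j nu j *: a j in
  y ^J n ** w = lambda ^+ n *: (w - e).
Proof.
move=> n0 nuX nuS ha w.
have n0C : n%:R != 0 :> R[i] by rewrite pnatr_eq0 -lt0n.
have h : y ^J n ** \sum_j nu j *: a j =
    (lambda ^+ n * n%:R) *: e + lambda ^+ n *: \sum_j nu j *: a j.
  rewrite jprod_sumr.
  under eq_bigr => j _.
    rewrite jprodZr (jinverse_pow _ (ha j)) nuX scalerDr scaler_sumr.
    under eq_bigr => i _.
      rewrite scalerA -exprS subnSK //.
      over.
    rewrite scalerA mulrC -scalerA.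
    over.
  rewrite big_split -scaler_sumr /= exchange_big /=; congr (_ + _).
  under eq_bigr do rewrite -scaler_suml.
  case: n n0 nu a nuX nuS {ha w n0C} => // n _ nu a nuX nuS.
  rewrite big_ord_recl [X in _ + X]big1 ?addr0 => [|i _]; last first.
    by rewrite lift0 nuS ?scale0r // subn_gt0 ltnS ltn_ord subSS ltnS leq_subr.
  congr (_ *: _); under eq_bigr do rewrite subn0 nuX.
  by rewrite sumr_const card_ord mulr_natr.
rewrite /w jprodZr h scalerDr !scalerA; set S := \sum_j _.
transitivity (- (lambda ^+ n) *: e + (- n%:R^-1 * lambda ^+ n) *: S);
  last by module.
by congr (_ *: _ + _); rewrite mulrC -mulrA mulrN divff // mulrN1.
Qed.

End powers.
End jordan_product.
End jordan_triple.

(** * Real-valued norms *)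

Section real_norm.
Variable R : realType.

(** Norms take values in R[i]; their real parts can be compared and computed
with in the ordered field R. *)
Definition nrm (V : normedZmodType R[i]) (x : V) : R := complex.Re `|x|.

Lemma nrmE (V : normedZmodType R[i]) (x : V) : `|x| = (nrm x)%:C.
Proof. by rewrite /nrm RRe_real // ger0_real. Qed.

Lemma nrm_ge0 (V : normedZmodType R[i]) (x : V) : 0 <= nrm x.
Proof. by rewrite -ler0c -nrmE. Qed.

Lemma nrm_eq0 (V : normedZmodType R[i]) (x : V) : nrm x = 0 -> x = 0.
Proof. by move=> x0; apply/eqP; rewrite -normr_eq0 nrmE x0. Qed.

Lemma nrm0 (V : normedZmodType R[i]) : nrm (0 : V) = 0.
Proof. by rewrite /nrm normr0. Qed.

Lemma nrmN (V : normedZmodType R[i]) (x : V) : nrm (- x) = nrm x.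
Proof. by rewrite /nrm normrN. Qed.

Lemma nrmD (V : normedZmodType R[i]) (x y : V) : nrm (x + y) <= nrm x + nrm y.
Proof. by rewrite -lecR [X in _ <= X]rmorphD /= -!nrmE ler_normD. Qed.

Lemma nrmB (V : normedZmodType R[i]) (x y : V) : nrm (x - y) <= nrm x + nrm y.
Proof. by rewrite (le_trans (nrmD _ _)) // nrmN. Qed.

Lemma nrm_sum (V : normedZmodType R[i]) (I : Type) (s : seq I) (P : pred I)
    (F : I -> V) :
  nrm (\sum_(i <- s | P i) F i) <= \sum_(i <- s | P i) nrm (F i).
Proof.
elim/big_rec2: _ => [|i y z _ h]; first by rewrite nrm0.
by rewrite (le_trans (nrmD _ _)) // lerD2l.
Qed.

Lemma nrmZ (V : normedModType R[i]) (k : R[i]) (x : V) :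
  nrm (k *: x) = nrm k * nrm x.
Proof. by apply: complexI; rewrite rmorphM /= -!nrmE normrZ. Qed.

Lemma nrmM (k l : R[i]) : nrm (k * l) = nrm k * nrm l.
Proof. by apply: complexI; rewrite rmorphM /= -!nrmE normrM. Qed.

Lemma nrmX (k : R[i]) n : nrm (k ^+ n) = nrm k ^+ n.
Proof. by apply: complexI; rewrite rmorphXn /= -!nrmE normrX. Qed.

Lemma nrmV (k : R[i]) : nrm k^-1 = (nrm k)^-1.
Proof. by apply: complexI; rewrite fmorphV /= -!nrmE normfV. Qed.

Lemma nrm_real (r : R) : nrm (r%:C) = `|r|.
Proof. by rewrite /nrm normc_def /= expr0n addr0 sqrtr_sqr. Qed.

Lemma nrm_gt0 (V : normedZmodType R[i]) (x : V) : x != 0 -> 0 < nrm x.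
Proof.
move=> x0; rewrite lt_neqAle nrm_ge0 andbT eq_sym.
by apply: contra_neq x0 => /nrm_eq0.
Qed.

Lemma ballE (V : normedModType R[i]) (x y : V) (d : R) :
  ball x d%:C y <-> nrm (x - y) < d.
Proof. by rewrite -ball_normE /ball_ /= nrmE ltcR. Qed.

End real_norm.

(** * Roots of unity and compactness of a segment *)

Section scalars.
Variable R : realType.

Lemma pow_lt_small (q eps : R) : 0 <= q < 1 -> 0 < eps ->
  exists m, forall n, (m <= n)%N -> q ^+ n < eps.
Proof.
move=> /andP[q0 q1] eps0.
have /cvgrPdist_lt/(_ eps eps0) [m _ hm] : q ^+ n @[n --> \oo] --> 0.
  by apply: cvg_expr; rewrite ger0_norm.
exists m => n mn; have := hm n mn; rewrite /= sub0r normrN ger0_norm //.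
by rewrite exprn_ge0.
Qed.

Lemma leq_exp3 n : (n <= expn 3 n)%N.
Proof. exact/ltnW/ltn_expl. Qed.

Definition cis (t : R) : R[i] := cos t +i* sin t.

Lemma cisD s t : cis (s + t) = cis s * cis t.
Proof.
rewrite /cis cosD sinD; apply/eqP; rewrite eq_complex /=.
by apply/andP; split; apply/eqP; ring.
Qed.

Lemma cis0 : cis 0 = 1.
Proof. by rewrite /cis cos0 sin0. Qed.

Lemma cisX t n : cis t ^+ n = cis (t *+ n).
Proof. by elim: n => [|n IH]; rewrite ?mulr0n ?cis0 // exprS IH mulrS cisD. Qed.

Lemma nrm_cis t : nrm (cis t) = 1.
Proof. by rewrite /nrm normc_def /= cos2Dsin2 sqrtr1. Qed.

Lemma cis2pi : cis (pi *+ 2) = 1.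
Proof. by rewrite /cis cos2pi sin2pi. Qed.

Lemma cis_neq1 t : 0 < t < pi *+ 2 -> cis t != 1.
Proof.
move=> /andP[t0 t2]; apply/eqP => /(congr1 (@complex.Re R)) /= h.
have : 0 < sin (t / 2).
  by apply: sin_gt0_pi; rewrite divr_gt0 //= ltr_pdivrMr // mulr_natr.
move: h; have {1}-> : t = (t / 2) *+ 2 by rewrite -mulr_natr divfK.
rewrite cos_mulr2n cos2sin2 mulr2n => h s0.
by have : 0 < sin (t / 2) ^+ 2 by [rewrite exprn_gt0]; lra.
Qed.

Lemma cis_continuous t0 (d : R) : 0 < d ->
  \forall t \near t0, nrm (cis t - cis t0) < d.
Proof.
move=> d0; have d2 : 0 < d / 2 by rewrite divr_gt0.
have hc : \forall t \near t0, `|cos t0 - cos t| < d / 2.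
  by have /cvgrPdist_lt := @continuous_cos R t0; apply.
have hs : \forall t \near t0, `|sin t0 - sin t| < d / 2.
  by have /cvgrPdist_lt := @continuous_sin R t0; apply.
near=> t.
have -> : cis t - cis t0 = (cos t - cos t0)%:C + 'i%C * (sin t - sin t0)%:C.
  by apply/eqP; rewrite eq_complex /=; apply/andP; split; apply/eqP; ring.
rewrite (le_lt_trans (nrmD _ _)) // nrmM !nrm_real.
have -> : nrm ('i%C : R[i]) = 1.
  by rewrite /nrm normc_def /= expr0n add0r expr1n sqrtr1.
rewrite mul1r (distrC (cos t)) (distrC (sin t)).
have h1 : `|cos t0 - cos t| < d / 2 by near: t.
have h2 : `|sin t0 - sin t| < d / 2 by near: t.
by rewrite (splitr d) ltrD.
Unshelve. all: by end_near. Qed.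

Lemma sum_root_of_unity (n m : nat) : (0 < m < n)%N ->
  \sum_(j < n) cis (pi *+ 2 / n%:R) ^+ (j * m) = 0.
Proof.
move=> /andP[m0 mn]; have n0 : (0 < n)%N by apply: leq_trans mn.
set om := cis _.
have n0R : n%:R != 0 :> R by rewrite pnatr_eq0 -lt0n.
have omn : om ^+ n = 1.
  by rewrite /om cisX -(mulr_natr (_ / _) n) divfK // cis2pi.
have om1 : om ^+ m != 1.
  rewrite /om cisX; apply: cis_neq1; rewrite -(mulr_natr (_ / _) m).
  have p0 : 0 < (pi : R) *+ 2 by rewrite pmulrn_lgt0 // pi_gt0.
  rewrite !mulr_gt0 ?invr_gt0 ?ltr0n //= mulrAC -mulrA gtr_pMr //.
  by rewrite ltr_pdivrMr ?ltr0n // mul1r ltr_nat.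
have := subrX1 (om ^+ m) n; rewrite -exprM mulnC exprM omn expr1n subrr.
move=> /esym/eqP; rewrite mulf_eq0 subr_eq0 (negPf om1) /= => /eqP h.
by rewrite -[RHS]h; apply: eq_bigr => j _; rewrite -exprM mulnC.
Qed.

(** Compactness of the segment, for a bound that exists near each of its
points. *)
Lemma segment_uniform_bound (a b : R) (P : R -> R -> Prop) :
    (forall K K' t, K <= K' -> P K t -> P K' t) ->
    (forall t, a <= t <= b -> exists K, \forall t' \near t, P K t') ->
  exists2 K, 0 < K & forall t, a <= t <= b -> P K t.
Proof.
move=> Pmono Ploc.
have : \forall K \near +oo, `[a, b] `<=` P K.
  apply: (iffLR (compact_near_coveringP _) (@segment_compact R a b)) => t.
  rewrite /= in_itv /= => /Ploc [K0 hK0].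
  exists ([set t' | P K0 t'], [set K | K0 <= K]).
    by split=> //=; exact: nbhs_pinfty_ge (num_real K0).
  by move=> [t' K] /= [Pt' K0K]; exact: Pmono Pt'.
move=> /(filterI (nbhs_pinfty_gt (num_real 0))) [K0 [_ hK]].
have K1 : K0 < K0 + 1 by rewrite ltrDl.
by have [Kpos Kb] := hK _ K1; exists (K0 + 1).
Qed.

End scalars.

(** * Boundedness of the Jordan product *)

Section jprod_norm.
Variables (R : realType) (E : JBTriple R) (e : E).
Local Notation "x ** y" := (@jprod R E e x y) (at level 40, left associativity).
Implicit Types (x y z w : E).

(** A bilinear map that is continuous at 0 is bounded. The constant M may
exceed 1, which is why norms of powers are only used along the powers of 3. *)
Lemma jprod_bounded : exists2 M : R, 0 < M &
  forall x y, nrm (x ** y) <= M * nrm x * nrm y.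
Proof.
have /cvgrPdist_lt /(_ 1 ltr01) /nbhs_ballP [d /= d0 hd] :=
  @triple_continuous R E ((0, e), 0).
have dC : d = (complex.Re d)%:C by rewrite RRe_real // ger0_real // ltW.
set r := complex.Re d in dC; have r0 : 0 < r by rewrite -(ltcR 0) -dC.
have hb x y : nrm x < r -> nrm y < r -> nrm (x ** y) < 1.
  move=> hx hy; have := hd ((x, e), y).
  rewrite /= triple0l sub0r normrN nrmE ltcR.
  apply; split; first split => /=.
  - by rewrite dC; apply/ballE; rewrite sub0r nrmN.
  - exact: ballxx.
  - by rewrite /= dC; apply/ballE; rewrite sub0r nrmN.
exists ((2 / r) ^+ 2); first by rewrite exprn_gt0 // divr_gt0.
move=> x y; have [->|x0] := eqVneq x 0.
  by rewrite jprod0l nrm0 mulr0 mul0r.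
have [->|y0] := eqVneq y 0; first by rewrite jprod0r nrm0 mulr0.
have nx := nrm_gt0 x0; have ny := nrm_gt0 y0.
have := hb ((r / 2 / nrm x)%:C *: x) ((r / 2 / nrm y)%:C *: y).
have px : 0 <= r / 2 / nrm x by rewrite !divr_ge0 ?nrm_ge0 // ltW.
have py : 0 <= r / 2 / nrm y by rewrite !divr_ge0 ?nrm_ge0 // ltW.
have r2 : r / 2 < r by rewrite gtr_pMr // invf_lt1 ?ltr1n.
rewrite jprodZl jprodZr !nrmZ !nrm_real (ger0_norm px) (ger0_norm py).
rewrite !divfK ?gt_eqF // => /(_ r2 r2) h.
have k0 : 0 < (2 / r) ^+ 2 * nrm x * nrm y.
  by do 2!apply: mulr_gt0 => //; rewrite exprn_gt0 // divr_gt0.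
rewrite -[leRHS]mulr1 -ler_pdivrMl //; apply/ltW; move: h.
congr (is_true (_ < _)).
by field; rewrite !gt_eqF.
Qed.

(** * Contractions and the Neumann series *)

(** The solution is the limit of the partial sums of b + T b + T^2 b + ... . *)
Lemma contraction_solve (T : E -> E) (b : E) :
  (forall x y, T (x + y) = T x + T y) ->
  (forall x, nrm (T x) <= 2^-1 * nrm x) -> exists a, a = b + T a.
Proof.
move=> TD Tle.
have TN x : T (- x) = - T x.
  have T0 : T 0 = 0.
    apply: nrm_eq0; apply/eqP; rewrite eq_le nrm_ge0 (le_trans (Tle 0)) //.
    by rewrite nrm0 mulr0.
  by apply/eqP; rewrite -subr_eq0 opprK -TD addNr T0.
pose s n := iter n (fun v => b + T v) 0.
have s_bound d : nrm (s d) <= 2 * nrm b.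
  elim: d => [|d IH]; first by rewrite nrm0 mulr_ge0 ?nrm_ge0.
  by rewrite (le_trans (nrmD _ _)) //; have := Tle (s d); lra.
have s_dist m d : nrm (s (m + d)%N - s m) <= 2^-1 ^+ m * (2 * nrm b).
  elim: m => [|m IH]; first by rewrite subr0 mul1r s_bound.
  have -> : s (m.+1 + d)%N - s m.+1 = T (s (m + d)%N - s m).
    by rewrite addSn TD TN /=; module.
  rewrite (le_trans (Tle _)) // exprS -mulrA.
  by rewrite ler_pM2l // invr_gt0.
have s_tail (d : R[i]) : 0 < d ->
    exists m, forall n, (m <= n)%N -> ball (s m) d (s n).
  move=> d0; have dC : d = (complex.Re d)%:C.
    by rewrite RRe_real // ger0_real // ltW.
  set r := complex.Re d in dC; have r0 : 0 < r by rewrite -(ltcR 0) -dC.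
  have hc := @cvg_geometric R (2 * nrm b) 2^-1.
  have /cvgrPdist_lt/(_ r r0) [m _ hm] : geometric (2 * nrm b) 2^-1 @ \oo --> 0.
    by apply: hc; rewrite ger0_norm ?invr_ge0 // invf_lt1 // ltr1n.
  exists m => n mn; rewrite dC; apply/ballE; rewrite -nrmN opprB.
  rewrite -(subnKC mn) (le_lt_trans (s_dist _ _)) //.
  have := hm m (leqnn _); rewrite /= sub0r normrN ger0_norm 1?mulrC //.
  by rewrite !mulr_ge0 ?nrm_ge0 ?exprn_ge0.
have : cvg (s @ \oo).
  apply/cauchy_cvgP/cauchy_exP => d d0; have [m hm] := s_tail d d0.
  by exists (s m); exists m.
move=> /cvg_ex [a sa]; exists a.
apply/eqP; rewrite -subr_eq0; apply/eqP/nrm_eq0/eqP.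
rewrite eq_le nrm_ge0 andbT; apply/ler_addgt0Pl => r r0; rewrite addr0.
have r2 : 0 < (r / 2)%:C :> R[i] by rewrite (ltcR 0) divr_gt0.
move/cvgrPdist_lt : sa => /(_ _ r2) [m _ hm].
have h1 := hm m (leqnn m); have h2 := hm m.+1 (leqnSn m).
rewrite /= !nrmE !ltcR in h1 h2.
have -> : a - (b + T a) = (a - s m.+1) - T (a - s m).
  by rewrite TD TN /=; module.
rewrite (le_trans (nrmB _ _)) //; have := Tle (a - s m).
have := nrm_ge0 (a - s m); lra.
Qed.

Hypothesis e_tri : tripotent e.

Lemma nrm_jpow_3exp y m : in_E2 e y -> opQ e y = y ->
  nrm (jpow e y (expn 3 m)) = nrm y ^+ expn 3 m.
Proof.
move=> hy ys; apply: complexI.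
by rewrite -nrmE jpow_3exp_norm // rmorphXn /= -nrmE.
Qed.

(** As M may exceed 1, multiplication by y/mu need not be a contraction, but
multiplication by c = (y/mu)^N is one for a large power N of 3. The finite sum
B of the y^i/mu^(i+1) satisfies (y - mu) B = c - e, so the inverse a solves
a = -B + c a. Each of the required equations for a has a defect v that is
transported by c, as all operators involved commute: v = c v, so v = 0. *)
Lemma jinverse_large y mu : in_E2 e y -> opQ e y = y -> nrm y < nrm mu ->
  exists a, jinverse e (y - mu *: e) a.
Proof.
move=> hy ys ymu; have [M M0 hM] := jprod_bounded.
have mu0 : 0 < nrm mu by rewrite (le_lt_trans (nrm_ge0 y)).
have muN0 : mu != 0 by apply/eqP => mu_eq0; rewrite mu_eq0 nrm0 ltxx in mu0.
have q01 : 0 <= nrm y / nrm mu < 1.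
  by rewrite divr_ge0 ?nrm_ge0 //= ltr_pdivrMr // mul1r.
have [|m hm] := pow_lt_small (eps := 2^-1 / M) q01.
  by rewrite divr_gt0 // invr_gt0.
have {hm} := hm _ (leq_exp3 m); set N := expn 3 m => hN.
pose c := mu ^- N *: jpow e y N.
have cle : M * nrm c < 2^-1.
  rewrite mulrC -ltr_pdivlMr //; apply: le_lt_trans hN.
  by rewrite /c nrmZ nrm_jpow_3exp // -/N exprMn mulrC -exprVn nrmX nrmV.
pose B := \sum_(i < N) mu ^- i.+1 *: jpow e y i.
set z := y - mu *: e.
have hz : in_E2 e z by apply: in_E2D => //; apply/in_E2N/in_E2Z/in_E2_e.
have zB : z ** B = c - e.
  rewrite /B /c; elim: (N) => [|n IH].
    by rewrite big_ord0 jprod0r expr0 invr1 scale1r subrr.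
  rewrite big_ord_recr /= jprodDr IH /z jprodZr jprodDl jprodNl jprodZl.
  rewrite (in_E2_pow e_tri hy).
  have -> : mu ^- n = mu * mu ^- n.+1 by rewrite exprS invfM mulVKf.
  by rewrite -jpowS; module.
have zzB : (z ** z) ** B = z ** c - z.
  transitivity (z ** (z ** B)); last by rewrite zB jprodDr jprodNr (jprod1r hz).
  rewrite /B !jprod_sumr.
  apply: eq_bigr => i _; rewrite !jprodZr; congr (_ *: _).
  rewrite /z !jprodE (jprodC e y e) hy (in_E2_e e_tri).
  rewrite !(in_E2_pow e_tri hy) (jpow_sqr e_tri hy).
  by rewrite (in_E2M e_tri hy (in_E2_pow e_tri hy i)) -!jpowS; module.
have cz v : z ** (c ** v) = c ** (z ** v).
  rewrite /z /c !jprodE (jpow_comm e_tri hy N v).1 (jprod_unit_comm e_tri) //.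
  exact: in_E2_pow.
have czz v : (z ** z) ** (c ** v) = c ** ((z ** z) ** v).
  rewrite /z !jprodE (jprodC e y e) hy (in_E2_e e_tri) /c ?jprodE.
  have [h1 h2] := jpow_comm e_tri hy N v.
  by rewrite h1 h2 (jprod_unit_comm e_tri) //; [module | exact: in_E2_pow].
have uniq v : v = c ** v -> v = 0.
  move=> vc; apply: nrm_eq0; apply/eqP; rewrite eq_le nrm_ge0 andbT.
  have := hM c v; rewrite -vc => h; have := nrm_ge0 v; nra.
have [|a ha] := @contraction_solve (jprod e c) (- B) (jprodDr e c).
  by move=> v; rewrite (le_trans (hM _ _)) // ler_wpM2r ?nrm_ge0 // ltW.
have hc : in_E2 e c by apply/in_E2Z/in_E2_pow.
have hB : in_E2 e B.
  rewrite /in_E2 /B jprod_sumr; apply: eq_bigr => i _.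
  by rewrite jprodZr in_E2_pow.
(* Bilinearity must not expand c, nor z, in the computations below. *)
clearbody B c z; exists a; split.
- apply/eqP; rewrite -subr_eq0; apply/eqP/uniq.
  by rewrite {1 2}ha !jprodE hB (jprod_unit_comm e_tri a hc); module.
- apply/eqP; rewrite -subr_eq0; apply/eqP/uniq.
  by rewrite {1}ha !jprodE zB cz (jprod1r hc); module.
- apply/eqP; rewrite -subr_eq0; apply/eqP/uniq.
  by rewrite {1}ha !jprodE zzB czz (jprodC e z c); module.
Qed.

(** * Resolvents *)

Section resolvent.
Variables (M K : R) (z w w' : E) (s : R[i]).
Hypotheses (M0 : 0 < M) (hM : forall x y, nrm (x ** y) <= M * nrm x * nrm y).
Hypotheses (hz : in_E2 e z) (hzw : jinverse e z w).
Hypotheses (hzw' : jinverse e (z + s *: e) w').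
Hypotheses (wK : nrm w <= K) (sMK : nrm s * M * K <= 3^-1).

Let N' := nrm w'.
Let K0 : 0 <= K. Proof. exact: le_trans (nrm_ge0 w) wK. Qed.

Let jprod_le x y a b : nrm x <= a -> nrm y <= b -> nrm (x ** y) <= M * a * b.
Proof.
move=> xa yb; rewrite (le_trans (hM x y)) //.
by rewrite ler_pM ?mulr_ge0 ?nrm_ge0 ?(ltW M0) // ler_pM2l.
Qed.

Let jU_le v B : nrm v <= B -> nrm (jU e w v) <= 3 * (M * K) ^+ 2 * B.
Proof.
move=> vB; have h1 := jprod_le wK (jprod_le wK vB).
have h2 := jprod_le (jprod_le wK wK) vB.
have -> : 3 * (M * K) ^+ 2 * B =
    M * K * (M * K * B) + M * K * (M * K * B) + M * (M * K * K) * B by ring.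
rewrite /jU mulr2n (le_trans (nrmB _ _)) // lerD // (le_trans (nrmD _ _)) //.
by rewrite lerD.
Qed.

(** The hypothesis on s makes each of the last two terms of [jinverse_shift]
at most a third of K and of ||w'||, respectively. *)
Lemma resolvent_bound : nrm w' <= 2 * K.
Proof.
have hU := jU_le (lexx N').
have h : nrm w' <= nrm w + nrm s * nrm (w ** w) + nrm s ^+ 2 * nrm (jU e w w').
  rewrite [in leLHS](jinverse_shift e_tri hz hzw hzw').
  rewrite (le_trans (nrmD _ _)) // !nrmZ nrmX lerD2r.
  by rewrite (le_trans (nrmB _ _)) // nrmZ.
have h1 := jprod_le wK wK.
have N0 : 0 <= N' := nrm_ge0 w'.
have s0 := nrm_ge0 s; have t0 : 0 <= nrm s * M * K by rewrite !mulr_ge0 // ltW.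
have h2 : nrm s * nrm (w ** w) <= 3^-1 * K.
  by rewrite (le_trans (ler_wpM2l s0 h1)) // !mulrA ler_wpM2r.
have h3 : nrm s ^+ 2 * nrm (jU e w w') <= 3^-1 * N'.
  have -> : 3^-1 * N' = 3 * (3^-1 * 3^-1) * N' by field.
  rewrite (le_trans (ler_wpM2l (exprn_ge0 2 s0) hU)) //.
  have -> : nrm s ^+ 2 * (3 * (M * K) ^+ 2 * N') =
      3 * (nrm s * M * K * (nrm s * M * K)) * N' by ring.
  by rewrite ler_wpM2r // ler_pM2l // ler_pM.
rewrite -/N' in h *; move: h2 h3 h wK.
move: (nrm s * _) (nrm s ^+ 2 * _) (nrm w) N' => a b c n; lra.
Qed.

Lemma resolvent_lipschitz : nrm (w' - w) <= 3 * M * K ^+ 2 * nrm s.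
Proof.
have hw' := resolvent_bound.
have h1 := jprod_le wK wK.
have hU := jU_le hw'.
have s0 := nrm_ge0 s; have t0 : 0 <= nrm s * M * K by rewrite !mulr_ge0 // ltW.
have -> : w' - w = - s *: (w ** w) + s ^+ 2 *: jU e w w'.
  by rewrite [in LHS](jinverse_shift e_tri hz hzw hzw'); module.
rewrite (le_trans (nrmD _ _)) // !nrmZ nrmN nrmX.
have h3 := ler_wpM2l s0 h1; have h4 := ler_wpM2l (exprn_ge0 2 s0) hU.
have -> : 3 * M * K ^+ 2 * nrm s =
  nrm s * (M * K * K) + 2 * (nrm s * (M * K * K)) by ring.
apply: lerD => //; apply: (le_trans h4).
have -> : nrm s ^+ 2 * (3 * (M * K) ^+ 2 * (2 * K)) =
  (nrm s * M * K * 3) * (2 * (nrm s * (M * K * K))) by ring.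
apply: ler_piMl; last by move: sMK; move: (nrm s * M * K) => a; lra.
by rewrite !mulr_ge0 // ltW.
Qed.

End resolvent.

Lemma subr_shift y (l l' : R[i]) : y - l' *: e = (y - l *: e) + (l - l') *: e.
Proof. by module. Qed.

Lemma resolvent_bounded_circle y (rho : R) : in_E2 e y -> 0 <= rho ->
    (forall l : R[i], nrm l = rho -> exists w, jinverse e (y - l *: e) w) ->
  exists2 K, 0 < K & forall t, 0 <= t <= pi *+ 2 -> forall w,
    jinverse e (y - (rho%:C * cis t) *: e) w -> nrm w <= K.
Proof.
move=> hy rho0 hinv; have [M M0 hM] := jprod_bounded.
apply: segment_uniform_bound => [K K' t KK' h w hw|t _].
  by rewrite (le_trans (h w hw)).
have [|w hw] := hinv (rho%:C * cis t).
  by rewrite nrmM nrm_cis mulr1 nrm_real ger0_norm.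
exists (2 * nrm w).
(* The inverse of this number is the radius around cis t within which the
   hypothesis of [resolvent_bound] on s holds; adding 1 keeps it positive. *)
have k0 : 0 < 3 * (rho + 1) * M * (nrm w + 1).
  have := nrm_ge0 w => w0; rewrite !mulr_gt0 // ltr_wpDl //.
have kV0 := k0; rewrite -invr_gt0 in kV0.
have := cis_continuous t kV0.
apply: filterS => t' ht' w' hw'.
rewrite (subr_shift y (rho%:C * cis t)) in hw'.
apply: (resolvent_bound M0 hM _ hw hw') => //.
  by apply: in_E2D => //; apply/in_E2N/in_E2Z/in_E2_e.
rewrite -mulrBr nrmM nrm_real ger0_norm // -nrmN opprB.
have := nrm_ge0 w; move: ht'; rewrite -[_^-1]mul1r ltr_pdivlMr // => ht' w0.
rewrite -[leRHS]mul1r ler_pdivlMr //; apply: le_trans (ltW ht').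
set c := nrm (_ - _) in ht' *; have c0 : 0 <= c := nrm_ge0 _.
have -> : rho * c * M * nrm w * 3 = c * (3 * rho * M * nrm w) by ring.
rewrite ler_wpM2l // !ler_pM // ?mulr_ge0 // ?lerDl // ?(ltW M0) //.
Qed.

(** * The norm of a self-adjoint element is attained on its spectrum *)

(** The averaging argument. Fix t > 0 small and rho' = rho + t, and write W r
for the average of [jinverse_average] on the circle of radius r. For n a large
power of 3, W rho' is close to e because (y/rho')^n is small, and W rho is
close to W rho' uniformly in n because the resolvent is Lipschitz. Then
y^n = y^n W rho - y^n (W rho - e) and y^n W rho = rho^n (W rho - e) make
||y^n|| smaller than rho^n. *)
Lemma selfadjoint_spectral_norm y :
  in_E2 e y -> opQ e y = y -> 0 < nrm y ->
  ~ forall l : R[i], nrm y <= nrm l -> exists w, jinverse e (y - l *: e) w.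
Proof.
move=> hy ys rho0 hinv; have [M M0 hM] := jprod_bounded.
set rho := nrm y in rho0 hinv.
have [a ha] : exists a : R[i] -> E, forall l, rho <= nrm l ->
    jinverse e (y - l *: e) (a l).
  exists (fun l => xget 0 (jinverse e (y - l *: e))) => l /hinv hl.
  exact: xgetPex.
have [K K0 hK] : exists2 K, 0 < K & forall t, 0 <= t <= pi *+ 2 ->
    nrm (a (rho%:C * cis t)) <= K.
  have [||K K0 hK] := @resolvent_bounded_circle y rho hy.
  - exact: ltW.
  - by move=> l hl; apply: hinv; rewrite hl.
  exists K => // t ht; apply: (hK t ht); apply: ha.
  by rewrite nrmM nrm_cis mulr1 nrm_real gtr0_norm.
pose L := 3 * M * K ^+ 2; have L0 : 0 < L by rewrite !mulr_gt0 // exprn_gt0.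
(* The last step needs (1 + M) eps < 1. *)
pose eps := 2^-1 / (1 + M).
have eps0 : 0 < eps by rewrite divr_gt0 ?invr_gt0 ?addr_gt0.
(* D is a Lipschitz constant for nu |-> nu (y - nu)^-1 across the annulus. *)
pose D := 2 * K + rho * L; have D0 : 0 < D by rewrite addr_gt0 // mulr_gt0.
have [t [t0 tMK tD]] :
    exists t, [/\ 0 < t, t * M * K <= 3^-1 & t * D <= eps / 2].
  have MK0 : 0 < M * K * 3 by rewrite !mulr_gt0.
  exists (Num.min (M * K * 3)^-1 (eps / 2 / D)); split.
  - by rewrite lt_min invr_gt0 MK0 /= divr_gt0 // divr_gt0.
  - rewrite -mulrA -ler_pdivlMr ?mulr_gt0 // ge_min.
    have -> : 3^-1 / (M * K) = (M * K * 3)^-1 by rewrite [RHS]invfM mulrC.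
    by rewrite lexx.
  - by rewrite -ler_pdivlMr // ge_min lexx orbT.
pose rho' := rho + t; have rho'0 : 0 < rho' by rewrite addr_gt0.
have [m hm] : exists m, forall n, (m <= n)%N ->
    (rho / rho') ^+ n < eps / 2 / (M * (rho' * (2 * K))).
  apply: pow_lt_small.
    rewrite divr_ge0 ?(ltW rho0) ?(ltW rho'0) //=.
    by rewrite ltr_pdivrMr // mul1r ltrDl.
  by apply: divr_gt0; [exact: divr_gt0 | rewrite !mulr_gt0].
have {hm} := hm _ (leq_exp3 m); set n := expn 3 m => hn.
have n0 : (0 < n)%N by rewrite expn_gt0.
have n0R : 0 < n%:R :> R by rewrite ltr0n.
pose th (j : 'I_n) : R := pi *+ 2 / n%:R *+ j.
have thP j : 0 <= th j <= pi *+ 2.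
  have p0 : 0 <= (pi : R) *+ 2 by rewrite mulrn_wge0 // pi_ge0.
  rewrite /th mulrn_wge0 ?divr_ge0 //= -(mulr_natr (_ / _) j) mulrAC.
  by rewrite ler_pdivrMr // ler_wpM2l // ler_nat ltnW.
pose om : R[i] := cis (pi *+ 2 / n%:R).
have thE j : cis (th j) = om ^+ j by rewrite cisX.
have omn : om ^+ n = 1.
  by rewrite /om cisX -(mulr_natr (_ / _) n) divfK ?gt_eqF // cis2pi.
pose nu (r : R) (j : 'I_n) := r%:C * cis (th j).
have nu_nrm r j : 0 <= r -> nrm (nu r j) = r.
  by move=> r0; rewrite nrmM nrm_cis mulr1 nrm_real ger0_norm.
pose W r := - n%:R^-1 *: \sum_j nu r j *: a (nu r j).
have avg_le (F : 'I_n -> E) B : (forall j, nrm (F j) <= B) ->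
    nrm ((- n%:R^-1 : R[i]) *: \sum_j F j) <= B.
  move=> FB; rewrite nrmZ nrmN nrmV -(rmorph_nat (real_complex R)) nrm_real.
  rewrite gtr0_norm //.
  rewrite ler_pdivrMl // (le_trans (nrm_sum _ _ _)) //.
  rewrite (le_trans (ler_sum _ (fun j _ => FB j))) // sumr_const card_ord.
  by rewrite mulr_natl.
have WE r : rho <= r -> jpow e y n ** W r = r%:C ^+ n *: (W r - e).
  move=> rr; apply: (jinverse_average e_tri hy n0) => [j|k hk|j].
  - by rewrite exprMn thE exprAC omn expr1n mulr1.
  - under eq_bigr => j _ do rewrite exprMn thE -exprM.
    by rewrite -mulr_sumr sum_root_of_unity // mulr0.
  - by apply: ha; rewrite nu_nrm // (le_trans (ltW rho0)).
have dist_nu j : nrm (nu rho j - nu rho' j) = t.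
  rewrite /nu /rho' -mulrBl -rmorphB nrmM nrm_cis mulr1 nrm_real.
  by rewrite opprD addNKr normrN gtr0_norm.
have dist_a j : nrm (a (nu rho' j) - a (nu rho j)) <= L * t /\
    nrm (a (nu rho' j)) <= 2 * K.
  have h0 : jinverse e (y - nu rho j *: e) (a (nu rho j)).
    by apply: ha; rewrite nu_nrm // ltW.
  have h1 : jinverse e (y - nu rho' j *: e) (a (nu rho' j)).
    by apply: ha; rewrite nu_nrm ?lerDl ltW.
  have hz : in_E2 e (y - nu rho j *: e).
    by apply: in_E2D => //; apply/in_E2N/in_E2Z/in_E2_e.
  rewrite (subr_shift y (nu rho j)) in h1.
  have aK := hK _ (thP j).
  have sMK : nrm (nu rho j - nu rho' j) * M * K <= 3^-1.
    by rewrite dist_nu.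
  split; last exact: (resolvent_bound M0 hM hz h0 h1).
  by rewrite -(dist_nu j); exact: (resolvent_lipschitz M0 hM hz h0 h1).
have W'_le : nrm (W rho') <= rho' * (2 * K).
  apply: avg_le => j; rewrite nrmZ (nu_nrm _ j (ltW rho'0)) ler_pM2l //.
  exact: (dist_a j).2.
have WW' : nrm (W rho - W rho') <= eps / 2.
  rewrite /W -scalerBr -sumrB; apply: avg_le => j; apply: le_trans tD.
  have -> : nu rho j *: a (nu rho j) - nu rho' j *: a (nu rho' j) =
      (nu rho j - nu rho' j) *: a (nu rho' j) -
      nu rho j *: (a (nu rho' j) - a (nu rho j)) by module.
  have [h1 h2] := dist_a j.
  rewrite (le_trans (nrmB _ _)) // !nrmZ dist_nu (nu_nrm _ j (ltW rho0)).
  rewrite /D mulrDr.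
  by apply: lerD; [rewrite ler_pM2l | rewrite mulrCA ler_pM2l // (mulrC t)].
have W'e : nrm (W rho' - e) <= eps / 2.
  have rr : rho <= rho' by rewrite lerDl ltW.
  have := hM (jpow e y n) (W rho').
  rewrite WE // nrmZ nrmX nrm_real gtr0_norm // nrm_jpow_3exp // -/rho => h.
  have rn'0 : 0 < rho' ^+ n by rewrite exprn_gt0.
  rewrite -(ler_pM2l rn'0) (le_trans h) //.
  have c0 : 0 <= M * rho ^+ n by rewrite ltW // mulr_gt0 // exprn_gt0.
  rewrite (le_trans (ler_wpM2l c0 W'_le)) //.
  move: hn; rewrite ltr_pdivlMr ?mulr_gt0 // expr_div_n mulrAC.
  rewrite ltr_pdivrMr // => /ltW h'.
  by rewrite [leRHS]mulrC; apply: le_trans h'; rewrite [leRHS]mulrA (mulrC M).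
have We : nrm (W rho - e) <= eps.
  have -> : W rho - e = (W rho - W rho') + (W rho' - e) by module.
  by rewrite (splitr eps) (le_trans (nrmD _ _)) // lerD.
have yn : nrm (jpow e y n) = rho ^+ n by rewrite nrm_jpow_3exp.
have rn0 : 0 < rho ^+ n by rewrite exprn_gt0.
have : rho ^+ n <= rho ^+ n * ((1 + M) * eps).
  rewrite -{1}yn -[jpow e y n](jprod1r (in_E2_pow e_tri hy n)).
  have -> : jpow e y n ** e = jpow e y n ** W rho - jpow e y n ** (W rho - e).
    by rewrite !jprodE; module.
  rewrite (le_trans (nrmB _ _)) // WE // nrmZ nrmX nrm_real gtr0_norm //.
  have h := hM (jpow e y n) (W rho - e); rewrite yn in h.
  rewrite (le_trans (lerD (lexx _) h)) //.
  have -> : rho ^+ n * nrm (W rho - e) + M * rho ^+ n * nrm (W rho - e) =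
    rho ^+ n * ((1 + M) * nrm (W rho - e)) by ring.
  by rewrite ler_pM2l // ler_pM2l // addr_gt0.
rewrite -[leLHS]mulr1 ler_pM2l // /eps mulrC divfK ?gt_eqF ?addr_gt0 //; lra.
Qed.
End jprod_norm.
(** * Density of the span of the tripotents *)

Section density.
Variables (R : realType) (E : JBTriple R).
Implicit Types (x y e : E).

(** Otherwise rho = ||x - (r/2) e|| > r/2. For |l| >= rho the number
mu = r/2 + l is not in the spectrum of x: a spectral value is real and
nonnegative, and then |l| > r/2 leaves only mu > r, which is excluded by the
Neumann series. This contradicts [selfadjoint_spectral_norm]. *)
Lemma jpositive_midpoint e x : tripotent e -> jpositive e x ->
  nrm (x - (nrm x / 2)%:C *: e) <= nrm x / 2.
Proof.
move=> e_tri [/peirce2E hx xs xpos]; set r := nrm x.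
have r0 : 0 <= r := nrm_ge0 x.
set y := x - _; rewrite leNgt; apply/negP => hr.
have hy : in_E2 e y by apply: in_E2D => //; apply/in_E2N/in_E2Z/in_E2_e.
have ys : opQ e y = y.
  rewrite /y /opQ tripleDm tripleNm tripleZm (e_tri : triple e e e = e).
  by rewrite (xs : triple e x e = x) conj_Creal // complex_real.
apply: (selfadjoint_spectral_norm e_tri hy ys) => [|l hl].
  by apply: le_lt_trans hr; rewrite divr_ge0.
have -> : y - l *: e = x - ((r / 2)%:C + l) *: e by rewrite /y; module.
set mu := _ + l.
have [[w [/peirce2E hw h1 h2]]|hn] := pselect (jinvertible e (x - mu *: e)).
  by exists w.
apply: (jinverse_large e_tri hx xs).
have mu0 : 0 <= mu by apply: xpos.
have muE : mu = (complex.Re mu)%:C by rewrite RRe_real // ger0_real.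
set m := complex.Re mu in muE; have m0 : 0 <= m by rewrite -ler0c -muE.
have lE : l = (m - r / 2)%:C by rewrite rmorphB /= -muE /mu addrAC subrr add0r.
move: hl; rewrite muE lE !nrm_real (ger0_norm m0) -/r => hl.
have := lt_le_trans hr hl; rewrite lter_normr => /orP[]; lra.
Qed.

Lemma tripotent_combinations0 : tripotent_combinations (0 : E).
Proof.
by exists 0%N, (fun=> 0), (fun=> 0); split=> [[]//|]; rewrite big_ord0.
Qed.

Lemma tripotent_combinationsD (k : R[i]) e y : tripotent e ->
  tripotent_combinations y -> tripotent_combinations (k *: e + y).
Proof.
move=> he [n [c [f [hf ->]]]].
exists n.+1, (fun i => oapp c k (unlift ord0 i)).
exists (fun i => oapp f e (unlift ord0 i)).
split=> [i|]; first by case: unliftP => [j|] _ /=.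
rewrite big_ord_recl unlift_none /=; congr (_ + _).
by apply: eq_bigr => i _; rewrite liftK.
Qed.

Lemma weakly_order_rickart_positive x : weakly_order_rickart E ->
  exists e, tripotent e /\ jpositive e x.
Proof.
move=> hE; have [||e [he hx _]] := hE x [set 0].
- split; first split=> // k a b -> ->; first by rewrite scaler0 addr0.
  by move=> a b c -> _; rewrite triple0l.
- by move=> a b _ -> z; rewrite /opL triple0m.
- by exists e.
Qed.

Lemma tripotent_approx x m : weakly_order_rickart E ->
  exists2 c, tripotent_combinations c & nrm (x - c) <= 2^-1 ^+ m * nrm x.
Proof.
move=> hE; elim: m => [|m [c hc xc]].
  by exists 0; [exact: tripotent_combinations0 | rewrite subr0 mul1r].
have [e [he hp]] := weakly_order_rickart_positive (x - c) hE.
exists ((nrm (x - c) / 2)%:C *: e + c); first exact: tripotent_combinationsD.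
rewrite opprD addrA addrAC (le_trans (jpositive_midpoint he hp)) //.
by rewrite exprS mulrC -mulrA ler_pM2l // invr_gt0.
Qed.

End density.

Theorem theorem4p5 (R : realType) (E : JBTriple R) :
  weakly_order_rickart E -> generated_by_tripotents E.
Proof.
move=> hE; apply/seteqP; split=> // x _ B /nbhs_ballP [d /= d0 dB].
have dC : d = (complex.Re d)%:C by rewrite RRe_real // ger0_real // ltW.
have r0 : 0 < complex.Re d by rewrite -(ltcR 0) -dC.
have x1 : 0 < nrm x + 1 by rewrite ltr_wpDl // nrm_ge0.
have [||m hm] := @pow_lt_small R 2^-1 (complex.Re d / (nrm x + 1)).
- by rewrite invr_ge0 ler0n invf_lt1 ?ltr1n.
- exact: divr_gt0.
have [c hc xc] := tripotent_approx x m hE.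
exists c; split=> //; apply: dB; rewrite dC; apply/ballE.
apply: le_lt_trans xc _.
apply: le_lt_trans (_ : 2^-1 ^+ m * (nrm x + 1) < _).
  by rewrite ler_wpM2l ?exprn_ge0 ?lerDl.
by rewrite -ltr_pdivlMr // hm.
Qed.
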